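(* Let $k$ and $t$ be positive integers. Then $$ s'_t([-k,k]) = \begin{cases} t+k^2-k & \text{if } \operatorname{lcm}(2,3,\ldots,\max(2,2k-1)) \mid t,\\ \infty & \text{otherwise.} \end{cases} $$
   Context: A sequence is a finite multiset of integers; for a sequence $S$, $|S|$ is its length (counted with multiplicity), $\sigma(S)$ is the sum of its terms, and $T \mid S$ means $T$ is a subsequence (sub-multiset) of $S$. $S$ is a zero-sum sequence if $\sigma(S)=0$. $S$ is $k$-bounded if all its terms lie in $[-k,k]$. For $t\in\mathbb N$, $s'_t([-k,k])$ denotes the minimal integer $\ell$ (or $\infty$ if none exists) such that every $k$-bounded zero-sum sequence $S$ with $|S|\ge \ell$ has a subsequence $T\mid S$ with $\sigma(T)=0$ and $|T|=t$. *)

(* Defs.v *)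
From mathcomp Require Import all_boot all_order all_algebra.
Set Implicit Arguments. Unset Strict Implicit. Unset Printing Implicit Defensive.
Import Order.TTheory GRing.Theory Num.Theory.

(* Sequences (finite multisets of integers) are represented by [seq int];
   only multiplicities matter in everything below. *)

Definition submultiset (T S : seq int) : Prop :=
  forall x : int, (count_mem x T <= count_mem x S)%N.

Definition kbounded (k : nat) (S : seq int) : Prop :=
  all (fun x : int => (- (k%:Z) <= x)%R && (x <= k%:Z)%R) S.

Definition zero_sum (S : seq int) : Prop := (\sum_(x <- S) x)%R = 0%R.

Definition s'_prop (k t l : nat) : Prop :=
  forall S : seq int, kbounded k S -> zero_sum S -> (l <= size S)%N ->
    exists T : seq int, submultiset T S /\ zero_sum T /\ size T = t.

(* [is_s' k t v] : v is the value of s'_t([-k,k]), where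
   [Some l] means the integer l and [None] means infinity. *)
Definition is_s' (k t : nat) (v : option nat) : Prop :=
  match v with
  | Some l => s'_prop k t l /\ (forall l', s'_prop k t l' -> (l <= l')%N)
  | None => forall l, ~ s'_prop k t l
  end.

Definition lcm_upto (m : nat) : nat := \big[lcmn/1%N]_(2 <= i < m.+1) i.

(* Main.v *)
Require Import Defs.
From mathcomp Require Import all_boot all_order all_algebra.
From mathcomp Require Import zify ring.
Set Implicit Arguments. Unset Strict Implicit. Unset Printing Implicit Defensive.
Import Order.TTheory GRing.Theory Num.Theory.

(** If [a, b <= k] are coprime, the zero-sum subsequences of copies of [a] and
    [- b] have lengths divisible by [a + b], so [a + b] must divide [t]; these
    sums have least common multiple [lcm (2, ..., max 2 (2k - 1))].  For sequences over
    [{k, k - 1, - 1}] the zero-sum lengths lie in the semigroup [<k + 1, k>], whose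
    Frobenius number is [k^2 - k - 1]; taking complements gives the lower bound.

    For the upper bound put [R = |S| - t >= k^2 - k]; by complementation it is
    enough to find a zero-sum subsequence of length [R].  Since [t] is large, either
    zeros do the job or some [a > 0] and [- b < 0] both occur often in [S].  If [R]
    is too large, a short zero-sum sequence made of [a] and [- b] is removed.
    Otherwise work modulo the lattice spanned by [(a, 1)] and [(- b, 1)] in [Z^2]
    (value, length), whose quotient is cyclic of order [a + b]: [S] without its
    [a]'s and [- b]'s has the same class as a zero-sum-free part [W] of fewer than
    [a + b] terms, and as [a + b] divides [a t], suitable numbers of [a]'s and
    [- b]'s complete [W] to a zero-sum sequence of length [R].  The point is that
    these numbers are nonnegative as soon as [R >= k^2 - k]. *)

(** * Complements, sign change and zero-sum-free parts modulo N *)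

Section Multisets.
Local Open Scope ring_scope.
Implicit Types (S T U V W : seq int) (k n : nat).

Lemma submultisetP T S : submultiset T S -> exists U, perm_eq S (T ++ U).
Proof.
move=> /count_subseqP [s sub_s eq_s].
have [U eqU] := perm_to_subseq sub_s; exists U.
by rewrite (perm_trans eqU) // perm_cat2r perm_sym.
Qed.

Lemma kbounded_perm k S T : perm_eq S T -> kbounded k S -> kbounded k T.
Proof. by move=> eqST; rewrite /kbounded (perm_all _ eqST). Qed.

Lemma zero_sum_perm S T : perm_eq S T -> zero_sum S -> zero_sum T.
Proof. by move=> eqST; rewrite /zero_sum (perm_big _ eqST). Qed.

Lemma zero_sum_catr T U : zero_sum (T ++ U) -> zero_sum T -> zero_sum U.
Proof. by rewrite /zero_sum big_cat /= => zTU zT; rewrite zT add0r in zTU. Qed.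

Lemma zero_sum_complement k S U :
    kbounded k S -> zero_sum S -> submultiset U S -> zero_sum U ->
  exists V, [/\ submultiset V S, kbounded k V, zero_sum V
              & (size U + size V = size S)%N].
Proof.
move=> bS zS /submultisetP [V eqS] zU; exists V; split.
- by move=> x; rewrite (permP eqS) count_cat leq_addl.
- by move/(kbounded_perm eqS): bS; rewrite /kbounded all_cat => /andP[].
- exact: zero_sum_catr (zero_sum_perm eqS zS) zU.
- by rewrite (perm_size eqS) size_cat.
Qed.

Lemma submultiset_trans S T U :
  submultiset S T -> submultiset T U -> submultiset S U.
Proof. by move=> sST sTU x; apply: leq_trans (sST x) (sTU x). Qed.

Lemma zero_sum_opp S : zero_sum S -> zero_sum (map -%R S).
Proof. by rewrite /zero_sum big_map sumrN => ->; rewrite oppr0. Qed.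

Lemma kbounded_opp k S : kbounded k S -> kbounded k (map -%R S).
Proof. by rewrite /kbounded all_map; apply: sub_all => x /=; lia. Qed.

Lemma count_opp x S : count_mem x (map -%R S) = count_mem (- x) S.
Proof. by rewrite count_map; apply: eq_count => y /=; lia. Qed.

Lemma sum_nseq n (x : int) : \sum_(y <- nseq n x) y = n%:Z * x.
Proof. by rewrite big_nseq iter_addr_0 -mulr_natl natz. Qed.

Lemma count_mul_le_sum (f : int -> int) S v :
    (forall x, x \in S -> 0 <= f x) ->
  (count_mem v S)%:Z * f v <= \sum_(x <- S) f x.
Proof.
elim: S => [|x S IH] f0; first by rewrite big_nil /= mul0r.
rewrite big_cons /= PoszD mulrDl lerD //; last first.
  by apply: IH => y yS; apply: f0; rewrite inE yS orbT.
case: eqP => [->|_]; first by rewrite mul1r.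
by rewrite mul0r; apply: f0; rewrite inE eqxx.
Qed.

(** The shifted terms [x + k] are nonnegative and add up to [k * size S], so the copies of [v] alone
    cannot exceed this total. *)
Lemma count_zero_sum k S v : kbounded k S -> zero_sum S ->
  (count_mem v S)%:Z * (v + k%:Z) <= k%:Z * (size S)%:Z.
Proof.
move=> bS zS.
have -> : k%:Z * (size S)%:Z = \sum_(x <- S) (x + k%:Z).
  by rewrite big_split /= zS add0r big_const_seq count_predT iter_addr_0; lia.
apply: (count_mul_le_sum (f := fun x => x + k%:Z)) => x xS.
by have := allP bS x xS; lia.
Qed.

(* Davenport's argument in Z/N: as long as N terms remain, two of the N + 1
   prefix sums agree mod N and the block between them can be discarded. *)
Lemma zero_sum_free_core (N : nat) (f : int -> int) S : (0 < N)%N ->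
  exists W, [/\ subseq W S, (size W < N)%N,
    (N%:Z %| \sum_(x <- S) f x - \sum_(x <- W) f x)%Z
    & W = [::] \/ ~ (N%:Z %| \sum_(x <- W) f x)%Z].
Proof.
move=> N0; have [n] := ubnP (size S); elim: n S => // n IH S leS.
have [ltSN|leNS] := ltnP (size S) N.
  have [dv|ndv] := boolP (N%:Z %| \sum_(x <- S) f x)%Z.
    by exists [::]; split=> //; [exact: sub0seq | rewrite big_nil subr0 | left].
  by exists S; split=> //; [rewrite subrr | right; exact/negP].
pose p i := `|((\sum_(x <- take i S) f x) %% N)%Z|%N.
have [|i [j [ltij ltj]]] := uniqPn 0%N (s := [seq p i | i <- iota 0 N.+1]) _.
  apply/negP => un; have := uniq_leq_size (s2 := iota 0 N) un.
  rewrite size_map !size_iota ltnn => lt_size; suff: false by []; apply: lt_size.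
  by move=> _ /mapP[i _ ->]; rewrite mem_iota /p; lia.
rewrite size_map size_iota in ltj.
rewrite !(nth_map 0%N) ?size_iota ?(ltn_trans ltij) // !nth_iota ?(ltn_trans ltij) //.
rewrite !add0n => eqp.
have defj : take j S = take i S ++ drop i (take j S).
  by rewrite -{1}(cat_take_drop i (take j S)) take_takel // ltnW.
pose B := drop i (take j S).
have dvB : (N%:Z %| \sum_(x <- B) f x)%Z.
  have Nneq0 : N%:Z != 0 by lia.
  move: eqp; rewrite /p defj big_cat -/B /= => eqp.
  have /eqP : ((\sum_(x <- take i S) f x + \sum_(x <- B) f x)
      = \sum_(x <- take i S) f x %[mod N])%Z.
    by move: eqp (modz_ge0 (\sum_(x <- take i S) f x) Nneq0)
      (modz_ge0 (\sum_(x <- take i S) f x + \sum_(x <- B) f x) Nneq0); lia.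
  by rewrite eqz_mod_dvd addrC addKr.
have eS : S = take i S ++ B ++ drop j S by rewrite catA -defj cat_take_drop.
have [|W [sW ltW dW fW]] := IH (take i S ++ drop j S).
  have : (size S = size (take i S) + (size B + size (drop j S)))%N.
    by rewrite {1}eS !size_cat.
  have : (size B = j - i)%N by rewrite size_drop size_take; case: ifP; lia.
  by rewrite size_cat; lia.
exists W; split=> //.
  apply: subseq_trans sW _; rewrite [X in subseq _ X]eS.
  by apply: cat_subseq => //; apply: suffix_subseq.
rewrite eS !big_cat /= addrCA -addrA rpredD //.
by move: dW; rewrite big_cat.
Qed.

End Multisets.

(** * Zero-sum subsequences of a prescribed length *)

Section Balance.
Local Open Scope ring_scope.
Implicit Types (S T U V W : seq int) (k n : nat).

Lemma sum_addc W (c : int) :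
  \sum_(x <- W) (x + c) = \sum_(x <- W) x + (size W)%:Z * c.
Proof. by rewrite big_split /= big_const_seq count_predT iter_addr_0 -mulr_natl natz. Qed.

Lemma sum_le_size W (c : int) :
  (forall x : int, x \in W -> x <= c) -> \sum_(x <- W) x <= (size W)%:Z * c.
Proof.
move=> leWc; rewrite -subr_le0 -mulrN -sum_addc.
by rewrite big_seq sumr_le0 // => x /leWc; rewrite subr_le0.
Qed.

Lemma sum_gap W (c : int) : (forall x : int, x \in W -> x <= c /\ x <> c - 1) ->
  \sum_(x <- W) x = (size W)%:Z * c \/ \sum_(x <- W) x <= (size W)%:Z * c - 2.
Proof.
elim: W => [|x W IH] leWc; first by rewrite big_nil mul0r; left.
have := leWc x (mem_head _ _); rewrite big_cons /= => xc.
have /IH : (forall x : int, x \in W -> x <= c /\ x <> c - 1).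
  by move=> y yW; apply: leWc; rewrite inE yW orbT.
rewrite intS mulrDl mul1r.
have gapD (u v m : int) : u <= c /\ u <> c - 1 -> v = m \/ v <= m - 2 ->
  u + v = c + m \/ u + v <= c + m - 2 by lia.
exact: gapD.
Qed.

(** With [b = c + 1] the difference of the two sides is [c * (k * (k - 3) + 1 - c)], negative only
    for [b = k] with [k] equal to 2 or 3. *)
Lemma mul_pred_le (k b : nat) : (0 < b <= k)%N ->
    ((b < k) || (k < 2) || (3 < k))%N ->
  (k%:Z + b%:Z - 1) * (k%:Z + b%:Z - 2) <= b%:Z * (k%:Z * (k%:Z - 1)).
Proof.
case: b => // c bk small; rewrite -subr_ge0.
have -> : c.+1%:Z * (k%:Z * (k%:Z - 1)) - (k%:Z + c.+1%:Z - 1) * (k%:Z + c.+1%:Z - 2)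
   = c%:Z * (k%:Z * (k%:Z - 3) + 1 - c%:Z) by rewrite intS; ring.
case: c => [|c] in bk small *; first by rewrite mul0r.
by apply: mulr_ge0 => //; nia.
Qed.

(** In both cases [b * m + s <= (k + b - 1) * (k + b - 2) + (a + b - 1)]: for [a = k] because the
    terms are at most [k - 1], for [a < k] because [m <= k + b - 2]. By [mul_pred_le] this is less
    than [b * R + (a + b)], so [i > -1]. *)
Lemma balance_ge0_generic (k a b R m : nat) (s i : int) :
    (0 < a <= k)%N -> (0 < b <= k)%N -> ((b < k) || (k < 2) || (3 < k))%N ->
    (k ^ 2 - k <= R)%N -> (m < a + b)%N ->
    s <= m%:Z * k%:Z -> (a = k -> s <= m%:Z * (k%:Z - 1)) ->
    b%:Z * (R%:Z - m%:Z) - s = (a + b)%:Z * i ->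
  0 <= i.
Proof.
move=> ak bk small kR ltm sk sk1 def_i.
suff lt_i : b%:Z * m%:Z + s < b%:Z * R%:Z + (a + b)%:Z.
  have : 0 < (a + b)%:Z * (i + 1).
    by clear -lt_i def_i; rewrite mulrDr -def_i mulrBr mulr1; lia.
  by rewrite pmulr_rgt0; [clear; lia | clear -ak; lia].
have leR : k%:Z * (k%:Z - 1) <= R%:Z.
  by clear -kR ak; rewrite mulrBr mulr1 -PoszM mulnn; lia.
have {leR} := ler_wpM2l (isT : 0 <= b%:Z) leR; have := mul_pred_le bk small.
have [eqak|neqak] := eqVneq a k.
  have : m%:Z * (b%:Z + k%:Z - 1) <= (k%:Z + b%:Z - 1) * (b%:Z + k%:Z - 1).
    by clear -eqak ltm bk; apply: ler_wpM2r; lia.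
  by move: (sk1 eqak); rewrite eqak; clear; lia.
have : m%:Z * (b%:Z + k%:Z) <= (a%:Z + b%:Z - 1) * (b%:Z + k%:Z).
  by clear -ltm; apply: ler_wpM2r; lia.
have : (a%:Z + b%:Z - 1) * (b%:Z + k%:Z - 1)
    <= (k%:Z + b%:Z - 2) * (b%:Z + k%:Z - 1).
  by clear -neqak ak bk; apply: ler_wpM2r; lia.
by move: sk; clear; lia.
Qed.

(* The quotient [i] is the number of copies of [a] that, together with copies of
   [- b], completes [W] to a zero-sum sequence of length [R].  Since [i] is an
   integer, it suffices to bound it strictly below by [-1]; for [k <= 3] and
   [b = k] the size bound alone does not give this. *)
Lemma balance_ge0 k (a b R : nat) (i : int) W :
    (0 < a <= k)%N -> (0 < b <= k)%N -> (k ^ 2 - k <= R)%N ->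
    kbounded k W -> a%:Z \notin W -> (size W < a + b)%N ->
    W = [::] \/ ~ ((a + b)%:Z %| \sum_(x <- W) (x - a%:Z))%Z ->
    b%:Z * (R%:Z - (size W)%:Z) - \sum_(x <- W) x = (a + b)%:Z * i ->
  0 <= i.
Proof.
move=> ak bk kR bW aW ltW fW def_i.
have leWk : (forall x : int, x \in W -> x <= k%:Z) by move=> x /(allP bW); lia.
have sW := sum_le_size leWk.
have sWk : a = k -> \sum_(x <- W) x <= (size W)%:Z * (k%:Z - 1).
  move=> eqak; apply: sum_le_size => x xW.
  have : x != a%:Z by apply: contraNneq aW => <-.
  by move: (leWk x xW); lia.
have sWk1 : a = (k - 1)%N -> \sum_(x <- W) x = (size W)%:Z * k%:Z
     \/ \sum_(x <- W) x <= (size W)%:Z * k%:Z - 2.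
  move=> eqak; apply: sum_gap => x xW.
  have : x != a%:Z by apply: contraNneq aW => <-.
  by move: (leWk x xW); lia.
have {}fW : size W = 0%N \/
    ~ ((a + b)%:Z %| \sum_(x <- W) x - (size W)%:Z * a%:Z)%Z.
  by case: fW => [->|]; [left | rewrite sum_addc mulrN; right].
have W0 : size W = 0%N -> \sum_(x <- W) x = 0.
  by move/size0nil ->; rewrite big_nil.
move: (\sum_(x <- W) x) (size W) => s m in sW sWk sWk1 fW W0 ltW def_i *.
have [small|large] := boolP ((b < k) || (k < 2) || (3 < k))%N.
  exact: balance_ge0_generic small kR ltW sW sWk def_i.
(* There remains [b = k]. For [a = k - 1] the value [i = -1] is excluded by the gap in [sWk1]; for
   [a = k] it would make the sum of the [x - a] over [W] divisible by [a + b], against [fW]. *)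
have [e|e] : k = 2%N \/ k = 3%N by lia.
  subst k; have e : b = 2%N by lia.
  subst b; have [e|e] : a = 1%N \/ a = 2%N by lia.
    by subst a; lia.
  by subst a; lia.
subst k; have e : b = 3%N by lia.
subst b; have [e|[e|e]] : a = 1%N \/ a = 2%N \/ a = 3%N by lia.
- by subst a; lia.
- by subst a; lia.
- by subst a; lia.
Qed.

Lemma dvd_sum_filter (N : int) (f : int -> int) (p : pred int) S :
    (forall x, ~~ p x -> (N %| f x)%Z) ->
  (N %| \sum_(x <- S) f x - \sum_(x <- filter p S) f x)%Z.
Proof.
move=> fN; rewrite big_filter [\sum_(x <- S) f x](bigID p) /= [X in X - _]addrC addrK.
by apply: rpred_sum => x /fN.
Qed.

Lemma zero_sum_of_length k (t a b R : nat) S :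
    (0 < a <= k)%N -> (0 < b <= k)%N -> (a + b %| a * t)%N ->
    kbounded k S -> zero_sum S -> size S = (t + R)%N -> (k ^ 2 - k <= R)%N ->
    (k * R <= count_mem a%:Z S * (a + k))%N ->
    (k * R <= count_mem (- b%:Z)%R S * (b + k))%N ->
  exists U, [/\ submultiset U S, zero_sum U & size U = R].
Proof.
move=> ak bk dvt bS zS sizeS kR cntA cntB.
pose p := [pred x : int | (x != a%:Z) && (x != - b%:Z)].
(* Both [a] and [- b] are sent to 0 modulo [a + b], so discarding their copies keeps the class of
   the sum of [f]. *)
pose f (x : int) := x - a%:Z.
have N0 : (0 < a + b)%N by lia.
have [W [sub_W ltW dvW fW]] := zero_sum_free_core f (filter p S) N0.
have subW : {subset W <= filter p S} := mem_subseq sub_W.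
have aW : a%:Z \notin W by apply/negP => /subW; rewrite mem_filter /= eqxx.
have nbW : - b%:Z \notin W.
  by apply/negP => /subW; rewrite mem_filter /= eqxx andbF.
have bW : kbounded k W.
  apply/allP => x /subW; rewrite mem_filter => /andP[_]; exact: (allP bS).
(* Over [S] the sum of [f] is [- a * (t + R)]. Adding the multiples [a * t] and
   [(a + b) * (R - size W)] of [a + b] to the difference of the sums over [S] and [W] gives this
   expression. *)
have dvi : ((a + b)%:Z %| b%:Z * (R%:Z - (size W)%:Z) - \sum_(x <- W) x)%Z.
  have dvF : ((a + b)%:Z %| \sum_(x <- S) f x - \sum_(x <- filter p S) f x)%Z.
    apply: dvd_sum_filter => x; rewrite /= negb_and !negbK /f.
    case/orP => /eqP ->; first by rewrite subrr dvdz0.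
    by rewrite -opprD -PoszD addnC rpredN dvdzz.
  have := rpredD dvF dvW; rewrite addrA subrK !sum_addc zS sizeS add0r.
  have dvt' : ((a + b)%:Z %| a%:Z * t%:Z)%Z by rewrite -PoszM.
  have dvN : ((a + b)%:Z %| (a + b)%:Z * (R%:Z - (size W)%:Z))%Z.
    exact: dvdz_mulr.
  move=> dvS; have := rpredD (rpredD dvS dvt') dvN.
  by congr (_ %| _)%Z; rewrite !PoszD; ring.
have [i def_i] := dvdzP dvi; rewrite [RHS]mulrC in def_i.
have i0 : 0 <= i by exact: balance_ge0 ak bk kR bW aW ltW fW def_i.
(* The number of copies of [- b]. Negating [W] exchanges the roles of [a] and [b], so [balance_ge0]
   applies to [j] as well. *)
pose j := R%:Z - (size W)%:Z - i.
have def_j : a%:Z * (R%:Z - (size (map -%R W))%:Z) - \sum_(x <- map -%R W) x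
     = (b + a)%:Z * j.
  rewrite size_map big_map sumrN /j opprK.
  have -> : (b + a)%:Z * (R%:Z - (size W)%:Z - i)
     = (b + a)%:Z * (R%:Z - (size W)%:Z) - (a + b)%:Z * i by rewrite addnC mulrBr.
  by rewrite -def_i PoszD; ring.
have j0 : 0 <= j.
  apply: (balance_ge0 bk ak kR (kbounded_opp bW) _ _ _ def_j).
  - apply/negP => /mapP[x xW eqx]; case/negP: nbW.
    by rewrite eqx opprK.
  - by rewrite size_map addnC.
  case: fW => [->|ndv]; [by left | right => dv; apply: ndv].
  have -> : \sum_(x <- W) f x
      = - (\sum_(x <- map -%R W) (x - b%:Z) + (size W)%:Z * (b + a)%:Z).
    rewrite !sum_addc big_map sumrN size_map PoszD; ring.
  rewrite rpredN [(a + b)%N]addnC; apply: rpredD; [exact: dv | exact: dvdz_mull].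
pose U := W ++ nseq `|i|%N a%:Z ++ nseq `|j|%N (- b%:Z).
have sizeU : size U = R by rewrite !size_cat !size_nseq /j; lia.
have zU : zero_sum U.
  rewrite /zero_sum !big_cat /= !sum_nseq !gez0_abs //.
  have -> : \sum_(x <- W) x = b%:Z * (R%:Z - (size W)%:Z) - (a + b)%:Z * i.
    by rewrite -def_i opprB addrC subrK.
  by rewrite /j PoszD; ring.
have bU : kbounded k U.
  rewrite /kbounded !all_cat !all_nseq; apply/and3P; split=> //; lia.
have anb : (a%:Z == - b%:Z) = false by lia.
exists U; split=> // x.
have cntU v : count_mem v U
    = (count_mem v W + (a%:Z == v) * `|i| + (- b%:Z == v) * `|j|)%N.
  by rewrite !count_cat !count_nseq addnA.
(* A [k]-bounded zero-sum [U] of length [R] has at most [k * R / (a + k)] copies of [a], which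
   [cntA] supplies; [- b] is treated likewise after a sign change. *)
have [->|xa] := eqVneq x a%:Z.
  have := count_zero_sum a%:Z bU zU; rewrite sizeU => leU.
  by rewrite -(leq_pmul2r (_ : 0 < a + k)%N) ?(leq_trans _ cntA) //; lia.
have [->|xb] := eqVneq x (- b%:Z).
  have := count_zero_sum b%:Z (kbounded_opp bU) (zero_sum_opp zU).
  rewrite size_map sizeU count_opp => leU.
  by rewrite -(leq_pmul2r (_ : 0 < b + k)%N) ?(leq_trans _ cntB) //; lia.
rewrite cntU !(eq_sym _ x) (negPf xa) (negPf xb) !addn0.
apply: leq_trans (leq_count_subseq _ sub_W) _.
by apply: leq_count_subseq; apply: filter_subseq.
Qed.

End Balance.

(** * Divisibility by the lcm and the size it forces on [t] *)

Lemma lcm_uptoP m t :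
  reflect (forall i, 2 <= i <= m -> i %| t) (lcm_upto m %| t).
Proof.
rewrite /lcm_upto big_nat_cond.
apply: (iffP idP) => [dvt i im | dvt].
  apply: dvdn_trans dvt; rewrite -big_nat_cond (bigD1_seq i) ?iota_uniq ?dvdn_lcml //=.
  by rewrite mem_index_iota; lia.
elim/big_ind: _ => [|x y xt yt|i]; first exact: dvd1n.
  by rewrite dvdn_lcm xt.
by rewrite andbT => im; apply: dvt; lia.
Qed.

(** The pairwise coprime numbers [2k - 1], [2k - 2], [2k - 3] give a cubic divisor of [t]. This
    suffices for [k = 3]; for larger [k] the divisor [2k - 5] supplies the missing linear factor, up
    to 3. *)
Lemma lcm_upto_large k t : 3 <= k -> 0 < t -> lcm_upto (2 * k - 1) %| t ->
  (k + 1) * (k * (k ^ 2 + k - 2) - 1) <= 2 * t.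
Proof.
move=> k3 t0 /lcm_uptoP dvt.
have [c def_k] : exists c, k = c + 3 by exists (k - 3); lia.
have coS n : coprime n n.+1 by rewrite coprime_sym coprimeSn.
have [u def_t] : exists u, t = u * ((2 * k - 1) * (2 * k - 2) * (2 * k - 3)).
  apply/dvdnP; rewrite !Gauss_dvd ?dvt //; try lia.
    have -> : 2 * k - 1 = (2 * k - 2).+1 by lia.
    by rewrite coprime_sym coS.
  rewrite coprimeMl; apply/andP; split; last first.
    have -> : 2 * k - 2 = (2 * k - 3).+1 by lia.
    by rewrite coprime_sym coS.
  rewrite /coprime; have -> : 2 * k - 1 = 2 + (2 * k - 3) by lia.
  rewrite gcdnC gcdnDr -/(coprime _ _) coprimen2; lia.
have u0 : 0 < u by move: t0; rewrite def_t; case: (u).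
have [k4|k4] := leqP 4 k; last first.
  have e : k = 3 by lia.
  by rewrite def_t e; lia.
(* The odd number [2k - 5] is coprime to [2k - 1] and [2k - 3], which exceed it by 4 and 2, and
   [2k - 2] is 3 modulo [2k - 5]. *)
have le3u : 2 * k - 5 <= 3 * u.
  apply: dvdn_leq; first lia.
  have : 2 * k - 5 %| t by apply: dvt; lia.
  have odd_k : odd (2 * k - 5) by lia.
  have -> : t = ((2 * k - 1) * (2 * k - 3)) * (u * (2 * k - 2)).
    by rewrite def_t; ring.
  rewrite Gauss_dvdr; last first.
    rewrite coprimeMr; apply/andP; split.
      have -> : 2 * k - 1 = 4 + (2 * k - 5) by lia.
      by rewrite /coprime gcdnDr -/(coprime _ _) -[4]/(2 ^ 2) coprimeXr // coprimen2.
    have -> : 2 * k - 3 = 2 + (2 * k - 5) by lia.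
    by rewrite /coprime gcdnDr -/(coprime _ _) coprimen2.
  have -> : u * (2 * k - 2) = 3 * u + u * (2 * k - 5) by nia.
  by rewrite dvdn_addl // dvdn_mull.
have [d def_k4] : exists d, k = d + 4 by exists (k - 4); lia.
have : 3 * ((k + 1) * (k * (k ^ 2 + k - 2) - 1)) <= 3 * (2 * t).
  have -> : 3 * (2 * t) = 3 * u * (2 * ((2 * k - 1) * (2 * k - 2) * (2 * k - 3))).
    by rewrite def_t; ring.
  apply: (leq_trans _ (leq_mul le3u (leqnn _))).
  have -> : 2 * k - 5 = 2 * d + 3 by lia.
  have -> : 2 * k - 1 = 2 * d + 7 by lia.
  have -> : 2 * k - 2 = 2 * d + 6 by lia.
  have -> : 2 * k - 3 = 2 * d + 5 by lia.
  apply: (@leq_trans (3 * ((k + 1) * (k * (k ^ 2 + k - 2))))).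
    by rewrite !leq_pmul2l //; lia.
  have -> : k ^ 2 + k - 2 = (d + 3) * (d + 6) by rewrite -mulnn def_k4; lia.
  rewrite def_k4; lia.
by rewrite leq_pmul2l.
Qed.

(** * Existence of a frequent positive value *)

Section Frequent.
Local Open Scope ring_scope.
Implicit Types (S T U V W : seq int) (k n : nat).

(* Since [S] is zero-sum, [size S] is the sum of the [x + 1], and the negative
   terms contribute at most [0]. *)
Lemma size_le_sum_count k S : kbounded k S -> zero_sum S ->
  (size S <= \sum_(0 <= v < k.+1) v.+1 * count_mem v%:Z S)%N.
Proof.
move=> bS zS; have -> : size S = `|(\sum_(x <- S) (x + 1))%R|%N.
  by rewrite sum_addc zS; lia.
suff : \sum_(x <- S) (x + 1) <= (\sum_(0 <= v < k.+1) v.+1 * count_mem v%:Z S)%N%:Z.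
  by have : 0 <= \sum_(x <- S) (x + 1); [rewrite sum_addc zS; lia | lia].
elim: S bS {zS} => [|x S IH] /=; first by rewrite big_nil.
move=> /andP[bx /IH {}IH]; rewrite big_cons.
have -> : (\sum_(0 <= v < k.+1) v.+1 * ((x == v%:Z) + count_mem v%:Z S)
    = \sum_(0 <= v < k.+1) v.+1 * (x == v%:Z)
      + \sum_(0 <= v < k.+1) v.+1 * count_mem v%:Z S)%N.
  by rewrite -big_split; apply: eq_bigr => v _; rewrite mulnDr.
rewrite PoszD lerD {IH}//=.
have [x0|x0] := ltP x 0; first by lia.
rewrite (bigD1_seq `|x|%N) ?iota_uniq ?mem_index_iota /=; [|lia|by []].
have -> : (x == `|x|%N) by lia.
lia.
Qed.

(** If every positive value is rare, the positive values contribute at most [t] to the bound of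
    [size_le_sum_count]; fewer than [k ^ 2 - k] zeros then make [S] too short. This is the count for
    [k >= 3]; smaller [k] are checked directly. *)
Lemma frequent_value k (t Q : nat) S :
    (0 < k)%N -> (0 < t)%N -> (lcm_upto (maxn 2 (2 * k - 1)) %| t)%N ->
    kbounded k S -> zero_sum S -> (t + (k ^ 2 - k) <= size S)%N ->
    (count_mem 0%R S = 0%N /\ Q = (k ^ 2 - k + maxn 2 (2 * k - 1) - 1)%N) \/
    ((count_mem 0%R S < Q)%N /\ Q = (k ^ 2 - k)%N) ->
  exists a : nat, (0 < a <= k)%N /\ (k * Q <= count_mem a%:Z S * (a + k))%N.
Proof.
move=> k0 t0 dvt bS zS leS defQ.
pose cnt (v : nat) : nat := count_mem v%:Z S.
pose P (v : 'I_k.+1) := (0 < v)%N && (k * Q <= cnt v * (v + k))%N.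
have [/existsP[v /andP[v0 freq]]|none] := boolP [exists v, P v].
  by exists v; split=> //; rewrite v0 -ltnS ltn_ord.
have rare v : (0 < v <= k)%N -> (cnt v * (v + k) < k * Q)%N.
  move=> /andP[v0 vk]; rewrite ltnNge; apply: contra none => freq.
  by apply/existsP; exists (Ordinal (vk : (v < k.+1)%N)); rewrite /P /= v0.
exfalso; have {bS zS} : (size S <= \sum_(0 <= v < k.+1) v.+1 * cnt v)%N.
  exact: size_le_sum_count.
change (count_mem 0%R S) with (cnt 0%N) in defQ.
rewrite big_nat_recl //= mul1n; move: (size S) leS => n leS.
clearbody cnt; clear S P none.
have [e|[e|k3]] : k = 1%N \/ k = 2%N \/ (3 <= k)%N by lia.
- subst k; rewrite big_nat1; have := rare 1%N isT.
  have : (2 %| t)%N by move/lcm_uptoP: dvt; apply.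
  by case: defQ => [[z0 ->]|[ltz eQ]]; lia.
- subst k; rewrite big_nat_recl // big_nat1; have := rare 1%N isT; have := rare 2%N isT.
  have : (2 %| t)%N by move/lcm_uptoP: dvt; apply.
  have : (3 %| t)%N by move/lcm_uptoP: dvt; apply.
  by case: defQ => [[z0 eQ]|[ltz eQ]]; rewrite ?eQ in rare *; lia.
have em : maxn 2 (2 * k - 1) = (2 * k - 1)%N by lia.
rewrite em in dvt defQ; have lt_t := lcm_upto_large k3 t0 dvt.
have lekk : (k <= k ^ 2)%N by rewrite -mulnn leq_pmulr.
have leQ : (Q <= k ^ 2 + k - 2)%N by case: defQ => [[_ ->]|[_ ->]]; clear -k3 lekk; lia.
(* For [1 <= v <= k] the ratio [(v + 1) / (v + k)] is largest at [v = k], where it is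
   [(k + 1) / (2k)]. *)
have le_sum : (2 * k * \sum_(0 <= v < k) v.+2 * cnt v.+1
     <= k * ((k + 1) * (k * Q - 1)))%N.
  rewrite big_distrr /= -[X in (_ <= X * _)%N]subn0 -sum_nat_const_nat.
  rewrite big_nat_cond [X in (_ <= X)%N]big_nat_cond.
  apply: leq_sum => v /andP[/andP[_ vk] _].
  apply: (@leq_trans ((k + 1) * (cnt v.+1 * (v.+1 + k)))).
    have : (2 * k * v.+2 <= (k + 1) * (v.+1 + k))%N by clear -vk; nia.
    by move=> /(leq_mul (leqnn (cnt v.+1))); lia.
  by rewrite leq_mul2l; have := rare v.+1 vk; lia.
move: (\sum_(0 <= v < k) _)%N => s in le_sum * => le_size.
have {}le_sum : (2 * s <= (k + 1) * (k * Q - 1))%N.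
  by rewrite -(leq_pmul2l k0); move: le_sum; clear; lia.
have leQ2 : ((k + 1) * (k * Q - 1) <= 2 * t)%N.
  apply: leq_trans lt_t; rewrite leq_mul2l leq_sub2r ?orbT //.
  by rewrite leq_mul2l leQ orbT.
have lt_z : (cnt 0%N < k ^ 2 - k)%N.
  case: defQ => [[-> _]|[ltz <-]] //; rewrite subn_gt0 -mulnn; clear -k3; nia.
by move: lt_z leQ2 le_sum le_size leS; clear; lia.
Qed.

End Frequent.

(** * The upper bound, the lower bound and the divisibility condition *)

Section Main.
Local Open Scope ring_scope.
Implicit Types (S T U V W : seq int) (k n : nat).

Lemma submultiset_nseq n (x : int) S :
  (n <= count_mem x S)%N -> submultiset (nseq n x) S.
Proof.
move=> le_n y; rewrite count_nseq /=.
by case: eqP => [<-|_]; rewrite ?mul1n.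
Qed.

Lemma submultiset_nseq2 (a b i j : nat) S : (0 < a)%N -> (0 < b)%N ->
    (i <= count_mem a%:Z S)%N -> (j <= count_mem (- b%:Z)%R S)%N ->
  submultiset (nseq i a%:Z ++ nseq j (- b%:Z)) S.
Proof.
move=> a0 b0 le_i le_j x; rewrite count_cat !count_nseq /=.
case: (eqVneq a%:Z x) => [<-|_].
  have -> : (- b%:Z == a%:Z) = false by lia.
  by rewrite mul1n addn0.
by case: (eqVneq (- b%:Z) x) => [<-|_]; rewrite ?mul1n.
Qed.

Lemma submultiset_sub T S : submultiset T S -> {subset T <= S}.
Proof.
move=> sTS x; rewrite -!has_pred1 !has_count => T0.
exact: leq_trans T0 (sTS x).
Qed.

Lemma upper_bound k t : (0 < k)%N -> (0 < t)%N ->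
    (lcm_upto (maxn 2 (2 * k - 1)) %| t)%N ->
  s'_prop k t (t + k ^ 2 - k).
Proof.
move=> k0 t0 dvt S.
have lekk : (k <= k ^ 2)%N by rewrite -mulnn leq_pmulr.
rewrite -addnBA //; have [n] := ubnP (size S).
elim: n S => // n IH S leSn bS zS leS.
have reduce U : submultiset U S -> zero_sum U -> (0 < size U)%N ->
    (size U + (t + (k ^ 2 - k)) <= size S)%N ->
  exists T, submultiset T S /\ zero_sum T /\ size T = t.
  move=> sUS zU U0 leU.
  have [V [sVS bV zV sizeV]] := zero_sum_complement bS zS sUS zU.
  have [||T [sTV zT]] := IH V _ bV zV; [lia | lia |].
  by exists T; split=> //; apply: submultiset_trans sTV sVS.
have finish U : submultiset U S -> zero_sum U -> (size U + t = size S)%N ->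
  exists T, submultiset T S /\ zero_sum T /\ size T = t.
  move=> sUS zU eqU.
  have [V [sVS _ zV sizeV]] := zero_sum_complement bS zS sUS zU.
  by exists V; do !split=> //; lia.
have zero_sum0 m : zero_sum (nseq m 0%R) by rewrite /zero_sum sum_nseq mulr0.
set z := count_mem 0%R S.
pose m := maxn 2 (2 * k - 1).
have [/andP[z0 ltS]|short] := boolP ((0 < z) && (t + (k ^ 2 - k) < size S))%N.
  by apply: (reduce (nseq 1 0%R)) => //; exact: submultiset_nseq.
have [/andP[manyz eqS]|few] :=
    boolP ((k ^ 2 - k <= z) && (size S == t + (k ^ 2 - k)))%N.
  apply: (finish (nseq (k ^ 2 - k) 0%R)) => //; first exact: submultiset_nseq.
  by rewrite size_nseq; lia.
(* [Q] is the largest excess [size S - t] treated without a reduction: with zeros present the excess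
   is exactly [k ^ 2 - k]; without zeros, any excess above [Q] leaves room to remove up to [m]
   terms. *)
have [Q [defQ QS]] : exists Q, ((z = 0 /\ Q = k ^ 2 - k + m - 1) \/
      (z < Q /\ Q = k ^ 2 - k))%N /\
    (Q = k ^ 2 - k + m - 1 \/ size S = t + Q)%N.
  have [z0|z0] := posnP z; first by exists (k ^ 2 - k + m - 1)%N; split; left.
  by exists (k ^ 2 - k)%N; split; right; lia.
have defQo : ((count_mem 0%R (map -%R S) = 0 /\ Q = k ^ 2 - k + m - 1) \/
      (count_mem 0%R (map -%R S) < Q /\ Q = k ^ 2 - k))%N.
  by rewrite count_opp oppr0.
have [a [ak freq_a]] := frequent_value k0 t0 dvt bS zS leS defQ.
have [|b [bk freq_b]] := frequent_value k0 t0 dvt (kbounded_opp bS) (zero_sum_opp zS) _ defQo.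
  by rewrite size_map.
rewrite count_opp in freq_b.
have [leR|ltR] := leqP (size S - t) Q.
  have dvat : (a + b %| a * t)%N.
    have [small|large] := leqP (a + b) m.
      by apply: dvdn_mull; move/lcm_uptoP: dvt; apply; rewrite small andbT; lia.
    (* Only [a = b = k] gives a sum above [m]; then [2k] divides [k * t] as soon as [t] is even. *)
    have [-> ->] : a = k /\ b = k by rewrite /m in large; clear -ak bk large; lia.
    rewrite addnn -muln2 dvdn_pmul2l //.
    by move/lcm_uptoP: dvt; apply; rewrite leq_maxl.
  have sizeS : size S = (t + (size S - t))%N by clear -leS; lia.
  have leR' : (k ^ 2 - k <= size S - t)%N by clear -leS; lia.
  have [||U [sUS zU sizeU]] :=
    zero_sum_of_length ak bk dvat bS zS sizeS leR'.
  - by apply: leq_trans freq_a; rewrite leq_mul2l leR orbT.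
  - by apply: leq_trans freq_b; rewrite leq_mul2l leR orbT.
  by apply: (finish U) => //; clear -sizeU leS; lia.
have eQ : Q = (k ^ 2 - k + m - 1)%N by case: QS => //; clear -ltR; lia.
have m2 : (2 <= m)%N by rewrite leq_maxl.
have ltmR : (m + (t + (k ^ 2 - k)) <= size S)%N.
  by move: ltR m2; rewrite eQ; clear; lia.
(* For [a = b] a pair is removed, as [a + b] may exceed [m]; for [a <> b] the [a + b] removed terms
   number at most [2k - 1]. *)
have [eqab|neqab] := eqVneq a b.
  subst b; apply: (reduce (nseq 1 a%:Z ++ nseq 1 (- a%:Z))) => //.
  - have kQ0 : (0 < k * Q)%N by rewrite muln_gt0 k0 eQ; clear -m2; lia.
    have [a0 _] := andP ak; apply: submultiset_nseq2 => //.
      by move: (leq_trans kQ0 freq_a); rewrite muln_gt0 => /andP[].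
    by move: (leq_trans kQ0 freq_b); rewrite muln_gt0 => /andP[].
  - by rewrite /zero_sum /= !big_cons big_nil addr0 subrr.
  by apply: leq_trans ltmR; rewrite leq_add2r.
have leQ : (2 * k <= Q)%N.
  have : (2 * k <= k ^ 2)%N by rewrite -mulnn leq_mul2r; clear -ak bk neqab; lia.
  by rewrite eQ /m; clear -ak bk neqab; lia.
have freq (c d : nat) : (d <= k)%N -> (k * Q <= c * (d + k))%N -> (k <= c)%N.
  move=> dk freq_c; rewrite -(leq_pmul2r (_ : 0 < 2 * k)%N) ?muln_gt0 //.
  apply: (leq_trans _ (leq_trans freq_c _)); first by rewrite leq_mul2l leQ orbT.
  by rewrite leq_mul2l; clear -dk; lia.
have [a0 lea] := andP ak; have [b0 leb] := andP bk.
apply: (reduce (nseq b a%:Z ++ nseq a (- b%:Z))) => //.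
- apply: submultiset_nseq2 => //.
    by apply: leq_trans leb _; exact: freq freq_a.
  by apply: leq_trans lea _; exact: freq freq_b.
- by rewrite /zero_sum big_cat /= !sum_nseq mulrN mulrC subrr.
- by rewrite size_cat !size_nseq addn_gt0 b0.
apply: leq_trans ltmR; rewrite leq_add2r size_cat !size_nseq /m.
by clear -lea leb neqab; lia.
Qed.

Lemma lower_bound k t l : (0 < k)%N -> (0 < t)%N -> s'_prop k t l ->
  (t + k ^ 2 - k <= l)%N.
Proof.
move=> k0 t0 sp; rewrite leqNgt; apply/negP => ltl.
have lekk : (k <= k ^ 2)%N by rewrite -mulnn leq_pmulr.
have [k1|k2] : k = 1%N \/ (2 <= k)%N by lia.
  subst k; have [||| T [sT [_ sizeT]]] := sp (nseq t.-1 0%R).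
  - by rewrite /kbounded all_nseq; apply/orP; right.
  - by rewrite /zero_sum sum_nseq mulr0.
  - by rewrite size_nseq; lia.
  have [U /perm_size] := submultisetP sT.
  by rewrite size_cat size_nseq sizeT; clear -t0; lia.
pose F := (k ^ 2 - k - 1)%N.
have F0 : (k ^ 2 - k = F.+1)%N.
  have : (2 * k <= k ^ 2)%N by rewrite -mulnn leq_mul2r k2 orbT.
  by rewrite /F; lia.
(* Beyond the Frobenius number [F]: if [t + F = q * k + r] with [r < k], then [q >= k - 1 >= r], and
   [r] of the [k] may be raised to [k + 1], provided [q] counts them. *)
have [a [b def_ab]] : exists a b : nat, (t + F = a * k.+1 + b * k)%N.
  have := divn_eq (t + F) k; set q := ((t + F) %/ k)%N; set r := ((t + F) %% k)%N.
  move=> def_q; have ltr : (r < k)%N by rewrite ltn_mod.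
  have le_kq : (k.-1 <= q)%N.
    by rewrite leq_divRL // -subn1 mulnBl mul1n mulnn F0; lia.
  exists r, (q - r)%N; rewrite def_q mulnS -addnA -mulnDl subnKC 1?addnC //.
  by clear -ltr le_kq; lia.
pose S := nseq a k%:Z ++ nseq b (k%:Z - 1) ++ nseq (a * k + b * (k - 1))%N (- 1 : int).
have sizeS U : submultiset U S -> zero_sum U ->
    size U = (count_mem k%:Z U * k.+1 + count_mem (k%:Z - 1)%R U * k)%N.
  move=> /submultiset_sub sUS zU; suff : (size U)%:Z + \sum_(x <- U) x
      = (count_mem k%:Z U * k.+1 + count_mem (k%:Z - 1)%R U * k)%N%:Z.
    by rewrite zU; lia.
  elim: U {zU} sUS => [|x U IH] sUS; first by rewrite big_nil.
  rewrite big_cons /= !mulnDl addnACA PoszD -IH; last first.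
    by move=> y yU; apply: sUS; rewrite inE yU orbT.
  have := sUS x (mem_head _ _); rewrite !mem_cat !mem_nseq.
  move: (\sum_(y <- U) y) (size U) => u n.
  by case/or3P => /andP[_ /eqP ->]; lia.
have zS : zero_sum S.
  rewrite /zero_sum !big_cat /= !sum_nseq !PoszD !PoszM -subzn //; ring.
have bS : kbounded k S.
  rewrite /kbounded !all_cat !all_nseq.
  by apply/and3P; split; apply/orP; right; lia.
have [|T [sTS [zT sizeT]]] := sp S bS zS.
  have : size S = (t + F)%N; last by lia.
  rewrite def_ab !size_cat !size_nseq mulnBr muln1.
  have : (b <= b * k)%N by rewrite leq_pmulr.
  by lia.
have [V [sVS _ zV sizeV]] := zero_sum_complement bS zS sTS zT.
have := sizeS V sVS zV; have sizeSV : size V = F.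
  have : size S = (t + F)%N; last by lia.
  rewrite def_ab !size_cat !size_nseq mulnBr muln1.
  have : (b <= b * k)%N by rewrite leq_pmulr.
  by lia.
rewrite sizeSV; move: (count_mem _ V) (count_mem _ V) => y x def_F.
(* [F] itself is not representable: [F + 1] is a multiple of [k], so [x + 1 >= k] and [x * (k + 1)]
   already exceeds [F]. *)
have dvk : (k %| x.+1)%N.
  have : (k %| x.+1 + (x + y) * k)%N.
    have -> : (x.+1 + (x + y) * k = F.+1)%N by rewrite def_F; clear; lia.
    by rewrite -F0 -mulnn dvdn_sub ?dvdn_mulr.
  by rewrite dvdn_addl // dvdn_mull.
have : (k * k.+1 <= x.+1 * k.+1)%N by rewrite leq_mul2r dvdn_leq ?orbT.
by move: F0 lekk; rewrite def_F -mulnn; clear -k0; lia.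
Qed.

(** If [x] copies of [a] balance [y] copies of [- b], coprimality forces [x = q * b] and
    [y = q * a], hence length [q * (a + b)]. *)
Lemma coprime_sum_dvd k t l (a b : nat) : (0 < a <= k)%N -> (0 < b <= k)%N ->
  coprime a b -> s'_prop k t l -> (a + b %| t)%N.
Proof.
move=> ak bk cop sp.
have [||| T [sT [zT sizeT]]] := sp (nseq (b * l) a%:Z ++ nseq (a * l) (- b%:Z)).
- by rewrite /kbounded all_cat !all_nseq; apply/andP; split; apply/orP; right; lia.
- by rewrite /zero_sum big_cat /= !sum_nseq !PoszM; ring.
- by rewrite size_cat !size_nseq -mulnDl leq_pmull //; lia.
have [] : size T = (count_mem a%:Z T + count_mem (- b%:Z)%R T)%N /\
    \sum_(x <- T) x = (count_mem a%:Z T)%:Z * a%:Z - (count_mem (- b%:Z)%R T)%:Z * b%:Z.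
  have := submultiset_sub sT; elim: T {sT zT sizeT} => [|x T IH] sTS.
    by rewrite big_nil !mul0r.
  have [|IH1 IH2] := IH.
    by move=> y yT; apply: sTS; rewrite inE yT orbT.
  rewrite big_cons /= IH1 IH2.
  have : (a%:Z == - b%:Z) = false /\ (- b%:Z == a%:Z) = false by split; lia.
  have := sTS x (mem_head _ _); rewrite !mem_cat !mem_nseq.
  by case/orP => /andP[_ /eqP ->] [ab ba]; rewrite ?ab ?ba eqxx add0n add1n ?addSn ?addnS intS;
    split=> //; ring.
move: (count_mem _ T) (count_mem _ T) => y x; rewrite zT sizeT => -> eqxy.
have {} eqxy : (x * a = y * b)%N by lia.
have /dvdnP[q def_x] : (b %| x)%N.
  have cop_ba : coprime b a by rewrite coprime_sym.
  by rewrite -(Gauss_dvdl _ cop_ba) eqxy dvdn_mull.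
have -> : y = (q * a)%N.
  apply/eqP; rewrite -(eqn_pmul2r (_ : 0 < b)%N); last by lia.
  by rewrite -eqxy def_x mulnAC.
by rewrite def_x -mulnDr addnC dvdn_mull.
Qed.

(** An odd [i] is [c + (c + 1)], and [i = 2c] with [c] even is [(c - 1) + (c + 1)], both coprime
    sums. For [c] odd, 2 and [c] are coprime and divide [t] separately. *)
Lemma lcm_dvd_of_s'_prop k t l : (0 < k)%N -> s'_prop k t l ->
  (lcm_upto (maxn 2 (2 * k - 1)) %| t)%N.
Proof.
move=> k0 sp.
have odd_dvd c : (0 < c < k)%N -> (c + c.+1 %| t)%N.
  by move=> ck; apply: coprime_sum_dvd sp; rewrite ?coprimenS //; lia.
have two_dvd : (2 %| t)%N by apply: (@coprime_sum_dvd k t l 1 1) sp.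
apply/lcm_uptoP => i im; have := odd_double_half i; set c := i./2 => def_i.
have [odd_i|even_i] := boolP (odd i).
  by have -> : i = (c + c.+1)%N; [lia | apply: odd_dvd; lia].
have [odd_c|even_c] := boolP (odd c); last first.
  have -> : i = (c.-1 + c.+1)%N by lia.
  apply: coprime_sum_dvd sp; try lia.
  have -> : (c.+1 = 2 + c.-1)%N by lia.
  by rewrite /coprime gcdnDr -/(coprime _ _) coprimen2; lia.
have -> : i = (2 * c)%N by lia.
rewrite Gauss_dvd ?coprime2n // two_dvd /=.
have [c1|c3] := leqP c 1; first by have -> : c = 1%N by lia.
have -> : c = (c./2 + c./2.+1)%N by lia.
by apply: odd_dvd; lia.
Qed.

End Main.

Theorem theorem1p2 (k t : nat) (hk : (0 < k)%N) (ht : (0 < t)%N) :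
  is_s' k t
    (if (lcm_upto (maxn 2 (2 * k - 1)) %| t)%N
     then Some (t + k ^ 2 - k)%N
     else None).
Proof.
case: ifPn => [dvt | ndvt] /=.
  by split=> [|l]; [exact: upper_bound | exact: lower_bound].
by move=> l /(lcm_dvd_of_s'_prop hk); apply/negP.
Qed.
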